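(* Suppose that $\mathbb S_1,\dots,\mathbb S_d$ are separable metric spaces and $\mathbb C_1,\dots,\mathbb C_d$ are closed subsets of $\mathbb S_1,\dots,\mathbb S_d$, respectively. If $\mu_n^{(i)}(\cdot)\to\mu^{(i)}(\cdot)$ in $\mathbb M(\mathbb S_i\setminus\mathbb C_i)$ for each $i=1,\dots,d$, then $$\mu_n^{(1)}\times\cdots\times\mu_n^{(d)}(\cdot)\to\mu^{(1)}\times\cdots\times\mu^{(d)}(\cdot)$$ in $$\mathbb M\Big(\Big(\prod_{i=1}^d\mathbb S_i\Big)\setminus\bigcup_{i=1}^d\Big(\Big(\prod_{j=1}^{i-1}\mathbb S_j\Big)\times\mathbb C_i\times\Big(\prod_{j=i+1}^d\mathbb S_j\Big)\Big)\Big).$$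
   Context: For a metric space $(\mathbb S,d)$ and a closed subset $\mathbb C\subseteq\mathbb S$, put $\mathbb C^r=\{x\in\mathbb S:d(x,\mathbb C)<r\}$ for $r>0$ (empty if $\mathbb C=\emptyset$). $\mathbb M(\mathbb S\setminus\mathbb C)$ is the class of Borel measures on $\mathbb S\setminus\mathbb C$ whose restrictions to $\mathbb S\setminus\mathbb C^r$ are finite for all $r>0$. Let $\mathcal C_{\mathbb S\setminus\mathbb C}$ be the set of real-valued, non-negative, bounded, continuous functions $f$ with $f(\mathbb C^r)=\{0\}$ for some $r>0$ (support bounded away from $\mathbb C$). $\mu_n\to\mu$ in $\mathbb M(\mathbb S\setminus\mathbb C)$ means $\int f\,d\mu_n\to\int f\,d\mu$ for each $f\in\mathcal C_{\mathbb S\setminus\mathbb C}$. Finite products of metric spaces carry the maximum metric $d((x_i),(y_i))=\max_id_{\mathbb S_i}(x_i,y_i)$. *)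

(* Defs.v *)
From HB Require Import structures.
From mathcomp Require Import all_boot all_order all_algebra.
From mathcomp Require Import all_classical all_reals all_analysis.

Set Implicit Arguments.
Unset Strict Implicit.
Unset Printing Implicit Defensive.
Import Order.TTheory GRing.Theory Num.Theory.
Import numFieldNormedType.Exports.
Local Open Scope classical_set_scope.
Local Open Scope ring_scope.

(* Pointed because measurableType requires it: metric spaces are nonempty. *)
#[short(type="pmetricType")]
HB.structure Definition PointedMetric (K : numDomainType) :=
  {M of Pointed M & Metric K M}.

Definition separable (T : topologicalType) :=
  exists2 D : set T, countable D & dense D.

Definition borel (T : ptopologicalType) := g_sigma_algebraType (@open T).

Definition prod_metric (R : realType) (d : nat) (S : 'I_d -> pmetricType R) :=
  forall i, S i.

Section prod_metric.
Context (R : realType) (d : nat) (S : 'I_d -> pmetricType R).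
Local Notation P := (prod_metric S).
Implicit Types x y z : P.

HB.instance Definition _ := Pointed.copy P (forall i, S i).

Definition max_dist x y : R := \big[Num.max/0]_(i < d) mdist (x i) (y i).

Lemma max_dist_ge0 x y : 0 <= max_dist x y.
Proof. exact: bigmax_ge_id. Qed.

Lemma max_dist_ge x y i : mdist (x i) (y i) <= max_dist x y.
Proof. exact: (le_bigmax _ (fun i => mdist (x i) (y i))). Qed.

Lemma max_dist_ltP x y e : 0 < e ->
  max_dist x y < e <-> forall i, mdist (x i) (y i) < e.
Proof.
move=> e0; split=> [xy i|xy]; first exact: le_lt_trans (max_dist_ge x y i) xy.
by apply/bigmax_ltP; split.
Qed.

Let max_distxx x : max_dist x x = 0.
Proof.
apply/eqP; rewrite eq_le max_dist_ge0 andbT.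
by apply/bigmax_leP; split=> // i _; rewrite mdistxx.
Qed.

Let max_dist_positivity x y : max_dist x y = 0 -> x = y.
Proof.
move=> xy0; apply: functional_extensionality_dep => i.
apply: mdist_positivity; apply/eqP; rewrite eq_le mdist_ge0 andbT -xy0.
exact: max_dist_ge.
Qed.

Let max_dist_sym x y : max_dist x y = max_dist y x.
Proof. by apply: eq_bigr => i _; rewrite metric_sym. Qed.

Let max_dist_triangle y x z : max_dist x z <= max_dist x y + max_dist y z.
Proof.
apply/bigmax_leP; split=> [|i _]; first by rewrite addr_ge0 ?max_dist_ge0.
by rewrite (le_trans (metric_triangle _ (y i) _))// lerD ?max_dist_ge.
Qed.

HB.instance Definition _ := @isMetric.Build R P max_dist
  max_distxx max_dist_positivity max_dist_sym max_dist_triangle.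

End prod_metric.

Section enlarge.
Context (R : realType) (S : pmetricType R).

(* edist_inf C x is the infimum of the distances from x to the points of C,
   hence +oo when C is empty *)
Definition enlarge (C : set S) (r : R) : set S :=
  [set x | (edist_inf C x < r%:E)%E].

Lemma enlargeP C r x : enlarge C r x <-> exists2 y, C y & mdist x y < r.
Proof.
split=> [/ereal_inf_lt[_ [y Cy <-]] /edist_lt_ball/=|[y Cy xyr]].
  by rewrite ballEmdist; exists y.
pose s : R := (mdist x y + r) / 2.
have [xs sr] : mdist x y < s /\ s < r by rewrite /s !midf_lt.
have s0 : 0 < s by exact: le_lt_trans (mdist_ge0 _ _) xs.
rewrite /enlarge/=; apply: le_lt_trans (_ : (s%:E < r%:E)%E); last by rewrite lte_fin.
apply: le_trans (_ : (edist (x, y) <= s%:E)%E).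
  by apply: ereal_inf_lbound; exists y.
by apply: edist_fin => //=; rewrite ballEmdist.
Qed.

Lemma open_enlarge C r : open (enlarge C r).
Proof.
rewrite (_ : enlarge C r = edist_inf C @^-1` [set e | (e < r%:E)%E])//.
apply: open_comp; last exact: open_ereal_lt_ereal.
by move=> x _; exact: edist_inf_continuous.
Qed.

Lemma closed_bigcap_enlarge C : closed C ->
  \bigcap_(n : nat) enlarge C n.+1%:R^-1 = C.
Proof.
move=> clC; apply/seteqP; split => [x Cx|x Cx n _]; last first.
  by apply/enlargeP; exists x => //; rewrite mdistxx invr_gt0.
apply: clC => B /nbhs_ballP[e /= e0 xeB].
have [n ne] : exists n : nat, n.+1%:R^-1 < e.
  exists (Num.truncn e^-1); rewrite invf_plt ?posrE//.
  exact: truncnS_gt.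
have /enlargeP[y Cy xy] := Cx n I.
by exists y; split=> //; apply: xeB; rewrite ballEmdist/= (lt_trans xy).
Qed.

End enlarge.

Section prod_measurable.
Context (d : nat) (disp : 'I_d -> measure_display)
  (T : forall i, measurableType (disp i)).

Definition cylinders : set (set (forall i, T i)) :=
  [set A | exists i, exists2 B, measurable B & A = [set x | B (x i)]].

Definition prod_measurable := g_sigma_algebraType cylinders.

Lemma measurable_cylinder i (B : set (T i)) : measurable B ->
  measurable ([set x | B (x i)] : set prod_measurable).
Proof. by move=> mB; apply: sub_sigma_algebra; exists i; exists B. Qed.

Lemma measurable_box (B : forall i, set (T i)) :
  (forall i, measurable (B i)) ->
  measurable ([set x | forall i, B i (x i)] : set prod_measurable).
Proof.
move=> mB.
rewrite (_ : [set _ | _] = \bigcap_(i in [set: 'I_d]) [set x | B i (x i)]).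
  apply: fin_bigcap_measurable => [|i _]; first exact: finite_finset.
  exact: measurable_cylinder.
by apply/seteqP; split => [x Bx i _|x Bx i]; exact: Bx.
Qed.

End prod_measurable.
Arguments cylinders {d disp} T.

Section dcons.
Context (d : nat) (T : 'I_d.+1 -> Type).

Definition dcons (x : T ord0) (y : forall i, T (lift ord0 i)) i : T i :=
  match unliftP ord0 i with
  | UnliftSome j ij => ecast k (T k) (esym ij) (y j)
  | UnliftNone i0 => ecast k (T k) (esym i0) x
  end.

Lemma dcons0 x y : dcons x y ord0 = x.
Proof.
rewrite /dcons; case: unliftP => [j e|e]; first by have := congr1 val e.
by rewrite (eq_axiomK e).
Qed.

Lemma dconsS x y i : dcons x y (lift ord0 i) = y i.
Proof.
rewrite /dcons; case: unliftP => [j e|e]; last by have := congr1 val e.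
have ij := lift_inj e; rewrite -{}ij in e *.
by rewrite (eq_axiomK e).
Qed.

End dcons.

Section prod_cons.
Context (d : nat) (disp : 'I_d.+1 -> measure_display)
  (T : forall i, measurableType (disp i)).
Local Notation Ttl := (fun i => T (lift ord0 i)).

Definition prod_cons (z : T ord0 * prod_measurable Ttl) : prod_measurable T :=
  dcons z.1 z.2.

Definition prod_uncons (x : prod_measurable T) : T ord0 * prod_measurable Ttl :=
  (x ord0, fun i => x (lift ord0 i)).

Lemma prod_consK : cancel prod_cons prod_uncons.
Proof.
move=> [x y]; rewrite /prod_uncons /prod_cons/= dcons0; congr pair.
by apply: functional_extensionality_dep => i; rewrite dconsS.
Qed.

Lemma measurable_prod_cons : measurable_fun setT prod_cons.
Proof.
apply: (@measurability _ _ _ (prod_measurable T) _ _ (cylinders T))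
  => // _ [_ [i [B mB ->]] <-].
rewrite setTI.
have [j|] := unliftP ord0 i => ij; move: B mB; rewrite {}ij => B mB.
  rewrite (_ : _ @^-1` _ = setT `*` [set y | B (y j)]).
    by apply: measurableX => //; exact: measurable_cylinder.
  by apply/seteqP; split => -[x y]/=; rewrite /prod_cons/= dconsS//; case.
rewrite (_ : _ @^-1` _ = B `*` setT); first exact: measurableX.
by apply/seteqP; split => -[x y]/=; rewrite /prod_cons/= dcons0//; case.
Qed.

Lemma measurable_prod_uncons : measurable_fun setT prod_uncons.
Proof.
apply: measurable_fun_pair.
  move=> _ B mB; rewrite setTI; exact: (measurable_cylinder mB).
apply: (@measurability _ _ _ (prod_measurable Ttl) _ _ (cylinders Ttl))
  => // _ [_ [i [B mB ->]] <-].
by rewrite setTI; exact: (measurable_cylinder mB).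
Qed.

End prod_cons.

Section prod_measure.
Context (R : realType).
Local Open Scope ereal_scope.

Section prod_measureS.
Context (d : nat) (disp : 'I_d.+1 -> measure_display)
  (T : forall i, measurableType (disp i)).
Local Notation Ttl := (fun i => T (lift ord0 i)).
Context (m : {sigma_finite_measure set (T ord0) -> \bar R})
  (m' : {sigma_finite_measure set (prod_measurable Ttl) -> \bar R}).

Definition prod_measureS : set (prod_measurable T) -> \bar R :=
  pushforward (m \x m') (@prod_cons d disp T).

Let prod_measureS0 : prod_measureS set0 = 0.
Proof. by rewrite /prod_measureS /pushforward preimage_set0 measure0. Qed.

Let prod_measureS_ge0 A : 0 <= prod_measureS A.
Proof. by rewrite /prod_measureS /pushforward measure_ge0. Qed.

Let prod_measureS_sigma_additive : semi_sigma_additive prod_measureS.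
Proof.
by apply: measure_semi_sigma_additive; exact: measurable_prod_cons.
Qed.

HB.instance Definition _ := isMeasure.Build _ _ _ prod_measureS
  prod_measureS0 prod_measureS_ge0 prod_measureS_sigma_additive.

Let prod_measureS_sigma_finite : sigma_finite setT prod_measureS.
Proof.
have /sigma_finiteP[F [TF ndF Foo]] := sigma_finiteT m.
have /sigma_finiteP[G [TG ndG Goo]] := sigma_finiteT m'.
exists (fun n => (@prod_uncons _ _ T) @^-1` (F n `*` G n)).
  rewrite -preimage_bigcup; apply/esym; rewrite -subTset => x _.
  have [k _ Fk] : (\bigcup_k F k) (x ord0) by rewrite -TF.
  have [l _ Gl] : (\bigcup_k G k) (fun i => x (lift ord0 i)) by rewrite -TG.
  exists (maxn k l) => //; split.
    by move: Fk; exact/subsetPset/ndF/leq_maxl.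
  by move: Gl; exact/subsetPset/ndG/leq_maxr.
move=> n; have [mFn Fnoo] := Foo n; have [mGn Gnoo] := Goo n.
have mFG : measurable (F n `*` G n) by exact: measurableX.
split.
  by rewrite -[X in measurable X]setTI; exact: measurable_prod_uncons.
rewrite /prod_measureS /pushforward -comp_preimage.
rewrite (_ : _ \o _ = id); last by apply/funext => z; exact: prod_consK.
by rewrite preimage_id product_measure1E// lte_mul_pinfty// ge0_fin_numE.
Qed.

HB.instance Definition _ := Measure_isSigmaFinite.Build _ _ _ prod_measureS
  prod_measureS_sigma_finite.

End prod_measureS.

Fixpoint prod_measure (d : nat) : forall (disp : 'I_d -> measure_display)
    (T : forall i, measurableType (disp i))
    (m : forall i, {sigma_finite_measure set (T i) -> \bar R}),
    {sigma_finite_measure set (prod_measurable T) -> \bar R} :=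
  match d with
  | 0%N => fun disp T m => \d_(point : prod_measurable T)
  | d'.+1 => fun disp T m =>
      prod_measureS (m ord0) (prod_measure (fun i => m (lift ord0 i)))
  end.

Lemma prod_measure_box d (disp : 'I_d -> measure_display)
    (T : forall i, measurableType (disp i))
    (m : forall i, {sigma_finite_measure set (T i) -> \bar R})
    (B : forall i, set (T i)) : (forall i, measurable (B i)) ->
  prod_measure m [set x | forall i, B i (x i)] = \prod_(i < d) m i (B i).
Proof.
elim: d => [|d IHd] in disp T m B * => mB /=.
  by rewrite big_ord0 diracE mem_set// => -[].
rewrite big_ord_recl/= -IHd//= /prod_measureS /pushforward.
have mB' := @measurable_box _ _ (fun i => T (lift ord0 i)) _
  (fun i => mB (lift ord0 i)).
rewrite -product_measure1E//.
congr (_ \x _)%E; apply/seteqP; split => -[x y]/= H.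
  split=> [|i]; first by have := H ord0; rewrite /prod_cons dcons0.
  by have := H (lift ord0 i); rewrite /prod_cons dconsS.
case: H => Bx By i; rewrite /prod_cons/=.
have [j|] := unliftP ord0 i => ->; last by rewrite dcons0.
by rewrite dconsS.
Qed.

End prod_measure.

Lemma open_metric_ball (R : realType) (S : metricType R) (x : S) (e : R) :
  open (ball x e).
Proof.
rewrite openE => y xy; apply/nbhs_ballP.
have {}xy : mdist x y < e by move: xy; rewrite ballEmdist.
exists (e - mdist x y); rewrite /= ?subr_gt0// => z; rewrite !ballEmdist/= => yz.
by rewrite (le_lt_trans (metric_triangle x y z))// -ltrBrDl.
Qed.

Section borel_prod.
Context (R : realType) (d : nat) (S : 'I_d -> pmetricType R).
Hypothesis sepS : forall i, separable (S i).
Local Notation BS := (fun i => borel (S i)).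

Definition to_borel (x : prod_measurable BS) : borel (prod_metric S) := x.

(* the Borel sigma-algebra of the product is contained in the product of the
   Borel sigma-algebras *)
Lemma measurable_to_borel : measurable_fun setT to_borel.
Proof.
apply: (@measurability _ _ _ (borel (prod_metric S)) _ _ open) => // _ [U oU <-].
rewrite setTI (_ : _ @^-1` U = U)//.
have [D cD] : exists D : forall i, set (S i), forall i, countable (D i) /\ dense (D i).
  have h i : exists Di : set (S i), countable Di /\ dense Di.
    by have [Di ? ?] := sepS i; exists Di.
  by exists (fun i => sval (cid (h i))) => i; case: cid.
pose bb (p : prod_metric S) (n : nat) : set (prod_metric S) :=
  [set x | forall i, ball (p i) n.+1%:R^-1 (x i)].
pose I := [set pn : prod_metric S * nat |
  (forall i, D i (pn.1 i)) /\ bb pn.1 pn.2 `<=` U].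
have cI : countable I.
  apply: (@sub_countable _ _ _ ([set p | forall i, D i (p i)] `*` [set: nat])).
    by apply: subset_card_le => -[p n] [].
  apply: countableX; last exact: countableP.
  have h i : exists f : S i -> nat, {in D i &, injective f}.
    by have [/countable_injP] := cD i.
  have [f finj] : exists f : forall i, S i -> nat, forall i, {in D i &, injective (f i)}.
    by exists (fun i => sval (cid (h i))) => i; case: cid.
  apply/countable_injP.
  exists (fun p : prod_metric S => pickle [ffun i => f i (p i)]).
  move=> p q; rewrite !inE => Dp Dq /(pcan_inj pickleK)/ffunP pq.
  apply: functional_extensionality_dep => i.
  by have := pq i; rewrite !ffunE; apply: finj; rewrite inE.
have -> : U = \bigcup_(pn in I) bb pn.1 pn.2.
  apply/seteqP; split => [x Ux|x [[p n] [_ +] /=]]; last by apply.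
  have /nbhs_ballP[e /= e0 xeU] : nbhs x U by exact: open_nbhs_nbhs.
  have [n ne] : exists n : nat, n.+1%:R^-1 < e / 2.
    exists (Num.truncn (e / 2)^-1).
    by rewrite invf_plt ?posrE ?divr_gt0// truncnS_gt.
  have h i : exists y, D i y /\ ball (x i) n.+1%:R^-1 y.
    have [y [? ?]] : ball (x i) n.+1%:R^-1 `&` D i !=set0.
      apply: (cD i).2; first by exists (x i); apply: ballxx; rewrite invr_gt0.
      exact: open_metric_ball.
    by exists y.
  pose p : prod_metric S := fun i => sval (cid (h i)).
  have pP i : D i (p i) /\ ball (x i) n.+1%:R^-1 (p i) by rewrite /p; case: cid.
  exists (p, n) => /=; last by move=> i; apply: ball_sym; exact: (pP i).2.
  split=> [i|z pz]; first exact: (pP i).1.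
  apply: xeU; rewrite ballEmdist/=; apply/max_dist_ltP => // i.
  have := ball_triangle (pP i).2 (pz i); rewrite ballEmdist/= => /lt_le_trans.
  by apply; rewrite ltW// [ltRHS]splitr ltrD.
rewrite bigcup_set_type; apply: countable_bigcupT_measurable => [|-[[p n] ?]/=].
  by rewrite (eq_countable (card_setT _)).
apply: (@measurable_box _ _ BS (fun i => ball (p i) n.+1%:R^-1)) => i.
exact: (@sub_sigma_algebra _ setT open _ (open_metric_ball _ _)).
Qed.

Lemma measurable_coord i :
  measurable_fun setT ((fun x => x i) : borel (prod_metric S) -> borel (S i)).
Proof.
apply: (@measurability _ _ _ (borel (S i)) _ _ open) => // _ [U + <-].
rewrite setTI openE => oU; apply: sub_sigma_algebra; rewrite openE => x /oU.
move=> /nbhs_ballP[e /= e0 xeU]; apply/nbhs_ballP; exists e => //= y.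
rewrite ballEmdist/= => /max_dist_ltP => /(_ e0)/(_ i) xye.
by apply: xeU; rewrite ballEmdist.
Qed.

End borel_prod.

(* The class M(S \ C).  As S \ C may be empty, hence not a measurableType, a
   Borel measure nu on S \ C is represented by the Borel measure
   A |-> nu (A `\` C) on S; for C closed, this is a bijection onto the Borel
   measures on S that give C no mass. *)
Record Mmeasure (R : realType) (S : pmetricType R) (C : set S) := MkMmeasure {
  Mmu :> {measure set (borel S) -> \bar R} ;
  Mmu_null : Mmu C = 0%E ;
  Mmu_fin : forall r, 0 < r -> (Mmu (~` enlarge C r) < +oo)%E
}.

(* Test functions are defined on all of S; since they vanish near C, they are
   the extensions by 0 of the corresponding functions on S \ C. *)
Definition test_function (R : realType) (S : pmetricType R) (C : set S)
    (f : S -> R) :=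
  [/\ forall x, 0 <= f x,
      exists M, forall x, f x <= M,
      continuous f
    & exists2 r, 0 < r & forall x, enlarge C r x -> f x = 0].

Definition Mcvg (R : realType) (S : pmetricType R) (C : set S)
    (mu_ : nat -> Mmeasure C) (mu : Mmeasure C) :=
  forall f, test_function C f ->
    (\int[mu_ n]_(x in ~` C) (f x)%:E)%E @[n --> \oo] -->
    (\int[mu]_(x in ~` C) (f x)%:E)%E.

Section Mmeasure_sigma_finite.
Context (R : realType) (S : pmetricType R) (C : set S) (clC : closed C).
Context (mu : Mmeasure C).

Lemma measurable_enlarge r : measurable (enlarge C r : set (borel S)).
Proof. apply: sub_sigma_algebra; exact: open_enlarge. Qed.

Lemma measurable_closed : measurable (C : set (borel S)).
Proof.
rewrite -[C]setCK; apply: measurableC; apply: sub_sigma_algebra.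
exact: closed_openC.
Qed.

(* closedness is what makes mu sigma-finite, hence it is an argument *)
Definition Msigma_finite of closed C : set (borel S) -> \bar R := mu.
Local Notation m := (Msigma_finite clC).

HB.instance Definition _ := Measure.copy m (mu : {measure set (borel S) -> \bar R}).

Let Msigma_finiteT : sigma_finite setT m.
Proof.
exists (fun n => if n is k.+1 then ~` enlarge C k.+1%:R^-1 else C).
  apply/esym; rewrite -subTset => x _; have [Cx|nCx] := pselect (C x).
    by exists 0%N.
  have : ~ (\bigcap_(n : nat) enlarge C n.+1%:R^-1) x.
    by rewrite closed_bigcap_enlarge.
  by move=> /existsNP[n /not_implyP[_ xn]]; exists n.+1.
case=> [|n]; split.
- exact: measurable_closed.
- by rewrite /Msigma_finite Mmu_null ltry.
- by apply: measurableC; exact: measurable_enlarge.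
- by rewrite /Msigma_finite Mmu_fin// invr_gt0.
Qed.

HB.instance Definition _ := Measure_isSigmaFinite.Build _ _ _ m Msigma_finiteT.

End Mmeasure_sigma_finite.

Section Mproduct.
Context (R : realType) (d : nat) (S : 'I_d -> pmetricType R).
Hypothesis sepS : forall i, separable (S i).
Context (C : forall i, set (S i)).
Arguments C : clear implicits.
Context (clC : forall i, closed (C i)).
Arguments clC : clear implicits.

(* the union over i of S_1 x ... x C_i x ... x S_d *)
Definition prod_removed : set (prod_metric S) :=
  \bigcup_(i in [set: 'I_d]) [set x | C i (x i)].

Context (mu : forall i, Mmeasure (C i)).

Definition Mprod_measure of (forall i, separable (S i)) :
    set (borel (prod_metric S)) -> \bar R :=
  pushforward (prod_measure (fun i => Msigma_finite (mu i) (clC i))) (@to_borel R d S).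
Local Notation P := (Mprod_measure sepS).

Let P0 : P set0 = 0%E.
Proof. by rewrite /Mprod_measure /pushforward preimage_set0 measure0. Qed.

Let P_ge0 A : (0 <= P A)%E.
Proof. by rewrite /Mprod_measure /pushforward measure_ge0. Qed.

Let P_sigma_additive : semi_sigma_additive P.
Proof. by apply: measure_semi_sigma_additive; exact: measurable_to_borel. Qed.

HB.instance Definition _ := isMeasure.Build _ _ _ P P0 P_ge0 P_sigma_additive.

Lemma Mprod_measure_box (B : forall i, set (borel (S i))) :
  (forall i, measurable (B i)) ->
  P [set x | forall i, B i (x i)] = (\prod_(i < d) mu i (B i))%E.
Proof.
move=> mB.
exact: (prod_measure_box (fun i => Msigma_finite (mu i) (clC i)) mB).
Qed.

Let measurable_slab i :
  measurable ([set x | C i (x i)] : set (borel (prod_metric S))).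
Proof.
rewrite -[X in measurable X]setTI.
by apply: (@measurable_coord _ _ S i) => //; exact: measurable_closed.
Qed.

Let P_slab i : P [set x | C i (x i)] = 0%E.
Proof.
pose B j : set (borel (S j)) := [set y | j = i -> C j y].
have Bi : B i = C i by apply/seteqP; split=> y; rewrite /B/=; [apply|].
have BT j : j != i -> B j = setT.
  by move=> /eqP ji; apply/seteqP; split => // y _ /ji.
rewrite (_ : [set x | _] = [set x | forall j, B j (x j)]); last first.
  apply/seteqP; split => [x Cx j ->//|x /(_ i)]; exact.
rewrite Mprod_measure_box => [|j]; last first.
  have [->|/BT->] := eqVneq j i; last exact: measurableT.
  by rewrite Bi; exact: measurable_closed.
by rewrite (bigD1 i)//= Bi Mmu_null mul0e.
Qed.

Let P_null : P prod_removed = 0%E.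
Proof.
apply: measure_negligible.
  by apply: fin_bigcup_measurable => //; exact: finite_finset.
pose F n : set (borel (prod_metric S)) :=
  if insub n is Some i then [set x | C i (x i)] else set0.
rewrite (_ : prod_removed = \bigcup_n F n).
  apply: negligible_bigcup => n; rewrite /F; case: insub => [i|].
    by apply/negligibleP => //; exact: P_slab.
  exact: negligible_set0.
apply/seteqP; split=> [x [i _ Cx]|x [n _]]; first by exists i => //; rewrite /F valK.
by rewrite /F; case: insub => // i Cx; exists i.
Qed.

Let P_fin r : 0 < r -> (P (~` enlarge prod_removed r) < +oo)%E.
Proof.
move=> r0; pose B i : set (borel (S i)) := ~` enlarge (C i) r.
have mB i : measurable (B i) by apply: measurableC; exact: measurable_enlarge.
have mBox : measurable ([set x | forall i, B i (x i)] : set (borel (prod_metric S))).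
  rewrite (_ : [set _ | _] = \bigcap_(i in [set: 'I_d]) [set x | B i (x i)]).
    apply: fin_bigcap_measurable => [|i _]; first exact: finite_finset.
    by rewrite -[X in measurable X]setTI; exact: measurable_coord.
  by apply/seteqP; split => [x Bx i _|x Bx i]; exact: Bx.
apply: (@le_lt_trans _ _ (P [set x | forall i, B i (x i)])).
  apply: le_measure; rewrite ?inE//.
    by apply: measurableC; exact: measurable_enlarge.
  move=> x nx i /enlargeP[y Cy xy]; apply: nx; apply/enlargeP.
  exists (dfwith x i y : prod_metric S); first by exists i => //=; rewrite dfwithin.
  apply/max_dist_ltP => // j; have [<-|ij] := eqVneq i j; first by rewrite dfwithin.
  by rewrite dfwithout// mdistxx.
rewrite Mprod_measure_box// -ge0_fin_numE; last first.
  by apply: prode_ge0 => i _; exact: measure_ge0.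
apply: (big_ind (fun x => x \is a fin_num)) => // [x y|i _].
  exact: fin_numM.
by rewrite ge0_fin_numE ?measure_ge0// Mmu_fin.
Qed.

(* the product measure as an element of M(prod_i S_i \ prod_removed); it is
   determined by its values on boxes, see Mproduct_box *)
Definition Mproduct : Mmeasure prod_removed := MkMmeasure P_null P_fin.

Lemma Mproduct_box (B : forall i, set (borel (S i))) :
  (forall i, measurable (B i)) ->
  Mproduct [set x | forall i, B i (x i)] = (\prod_(i < d) mu i (B i))%E.
Proof. exact: Mprod_measure_box. Qed.

End Mproduct.
Arguments Mproduct {R d S} sepS {C} clC mu.

(* Main.v *)
Require Import Defs.
From HB Require Import structures.
From mathcomp Require Import all_boot all_order all_algebra.
From mathcomp Require Import all_classical all_reals all_analysis.
From mathcomp Require Import measurable_realfun ring lra.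

(** Write [P_n], [P] for the product measures and [tensor u] for the function
    [x |-> \prod_i u_i (x_i)].  If every [u_i] is a test function for [C_i],
    then Tonelli's theorem gives
      [\int tensor u dP_n = \prod_i \int u_i dmu_n^(i)],
    which converges to [\int tensor u dP].  The task is to pass from these
    functions to a general test function [f] on the product.

    Localisation.  If [f] vanishes within distance [r] of the removed set,
    choose test functions [phi_i] (Urysohn functions) equal to 1 at distance at
    least [r] from [C_i].  Then [f = f * Phi] with [Phi = tensor phi], so that
    everything happens against the measures [Phi dP_n], whose total masses are
    finite and converge to that of [Phi dP].

    Approximation.  Since the factors are separable and [f] is continuous, there
    are countably many tensors [h_k], with values in [0, 1], such that [f] is
    within [e] of a constant [c_k] where [h_k] does not vanish, and such that at
    each point some [h_k] equals 1 ([tensor_partition]).  Set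
    [rho_K = \prod_(k < K) (1 - h_k)].  The functions [h_k * rho_k] with [k < K]
    are nonnegative with sum [1 - rho_K], whence ([partition_sum_dist])
      [|f - \sum_(k < K) c_k h_k rho_k| <= e + M rho_K]    if [0 <= f <= M].
    Both the sum and [rho_K] are linear combinations of tensors, because
    products of tensors are tensors, so that their integrals against [Phi dP_n]
    converge ([tensor_tested_leftover], [tensor_tested_partition_sum]).
    Finally [rho_K] is eventually 0 at each point, hence [\int rho_K Phi dP]
    tends to 0 by dominated convergence: the error integrates to an arbitrarily
    small amount against [Phi dP], and therefore also against [Phi dP_n] for [n]
    large, which is what [integral_cvg_approx] requires. *)

Set Implicit Arguments.
Unset Strict Implicit.
Unset Printing Implicit Defensive.
Import Order.TTheory GRing.Theory Num.Theory.
Import numFieldNormedType.Exports.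
Local Open Scope classical_set_scope.
Local Open Scope ring_scope.

(** * Sums weighted by a sequential partition of unity *)

Section partition.
Context (R : realType) (X : Type).
Implicit Types (h : nat -> X -> R) (c : nat -> R) (f : X -> R).

(** The mass left over by the first [k] steps when step [j] takes the fraction
    [h j x] of what remains; step [k] takes [h k x * leftover h k x]. *)
Definition leftover h k x : R := \prod_(j < k) (1 - h j x).

Lemma leftoverS h k x :
  leftover h k.+1 x = leftover h k x - h k x * leftover h k x.
Proof. by rewrite /leftover big_ord_recr/=; ring. Qed.

Lemma leftover_itv h k x : (forall j, 0 <= h j x <= 1) ->
  0 <= leftover h k x <= 1.
Proof.
move=> h01; elim: k => [|k /andP[r0 r1]].
  by rewrite /leftover big_ord0 ler01 lexx.
rewrite leftoverS; have /andP[h0 h1] := h01 k; apply/andP; split; nra.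
Qed.

Definition partition_sum h c K x : R :=
  \sum_(k < K) c k * (h k x * leftover h k x).

(** The weights of [partition_sum h c K] at [x] sum to [1 - leftover h K x], and
    only those [c k] with [`|f x - c k| <= e] have a nonzero weight. *)
Lemma partition_sum_dist h c f e M K x : (forall j, 0 <= h j x <= 1) ->
    0 <= f x <= M -> (forall k, h k x != 0 -> `|f x - c k| <= e) -> 0 <= e ->
  `|f x - partition_sum h c K x| <= e + M * leftover h K x.
Proof.
move=> h01 /andP[f0 fM] fc e0.
(* the part of f x carried by the weights, compared with the sum *)
suff H : `|f x * (1 - leftover h K x) - partition_sum h c K x| <=
    e * (1 - leftover h K x).
  rewrite (_ : f x - _ = (f x * (1 - leftover h K x) - partition_sum h c K x) +
    f x * leftover h K x); last by ring.
  have /andP[r0 r1] := leftover_itv K h01.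
  apply: le_trans (ler_normD _ _) _; apply: lerD.
    by apply: le_trans H _; nra.
  by rewrite ger0_norm ?mulr_ge0// ler_wpM2r.
elim: K => [|K IH].
  by rewrite /partition_sum /leftover !big_ord0 subrr !mulr0 subr0 normr0.
rewrite /partition_sum big_ord_recr/= -/(partition_sum h c K x) leftoverS.
have /andP[r0 r1] := leftover_itv K h01; have /andP[hK0 hK1] := h01 K.
have step : `|(f x - c K) * (h K x * leftover h K x)| <=
    e * (h K x * leftover h K x).
  rewrite normrM (ger0_norm (mulr_ge0 hK0 r0)).
  have [->|/fc H] := eqVneq (h K x) 0; first by rewrite !mul0r !mulr0.
  by rewrite ler_wpM2r// mulr_ge0.
set r := leftover h K x in IH step *; set q := partition_sum h c K x in IH *.
rewrite (_ : _ - _ = (f x * (1 - r) - q) + (f x - c K) * (h K x * r));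
  last by ring.
apply: le_trans (ler_normD _ _) _; apply: le_trans (lerD IH step) _.
by rewrite le_eqVlt; apply/orP; left; apply/eqP; ring.
Qed.

End partition.

(** * Convergence of integrals along a sequence of measures *)

Section integral_cvg.
Context (d : measure_display) (T : measurableType d) (R : realType).
Context (m_ : nat -> {measure set T -> \bar R}) (m : {measure set T -> \bar R}).
Implicit Types F G E : T -> R.

Definition integral_cvg F := [/\ forall n, (m_ n).-integrable setT (EFin \o F),
  m.-integrable setT (EFin \o F) &
  Rintegral (m_ n) setT F @[n --> \oo] --> Rintegral m setT F].

Lemma integral_cvgD F G : integral_cvg F -> integral_cvg G ->
  integral_cvg (fun x => F x + G x).
Proof.
move=> [Fn Fm Fc] [Gn Gm Gc]; split => [n||].
- exact: (integrableD measurableT (Fn n) (Gn n)).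
- exact: (integrableD measurableT Fm Gm).
- rewrite RintegralD//; under eq_fun do rewrite RintegralD//.
  exact: cvgD.
Qed.

Lemma integral_cvgZ c F : integral_cvg F -> integral_cvg (fun x => c * F x).
Proof.
move=> [Fn Fm Fc]; split => [n||].
- exact: (integrableZl measurableT c (Fn n)).
- exact: (integrableZl measurableT c Fm).
- rewrite RintegralZl//; under eq_fun do rewrite RintegralZl//.
  exact: cvgMl_tmp.
Qed.

(** Integration turns [`|F - G| <= E] into a bound of [\int F dm_n - \int F dm]
    by [\int E dm_n + \int E dm] and a null sequence.  Smallness of [\int E]
    under [m] is enough, as the convergence for [E] transports it to [m_ n]. *)
Lemma integral_cvg_approx F : measurable_fun setT F ->
  (forall e, 0 < e -> exists G E, [/\ integral_cvg G, integral_cvg E,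
     forall x, `|F x - G x| <= E x & Rintegral m setT E < e]) ->
  integral_cvg F.
Proof.
move=> mF approx.
have Fint (nu : {measure set T -> \bar R}) G E :
    nu.-integrable setT (EFin \o G) -> nu.-integrable setT (EFin \o E) ->
    (forall x, `|F x - G x| <= E x) ->
    nu.-integrable setT (EFin \o F) /\
    `|Rintegral nu setT F - Rintegral nu setT G| <= Rintegral nu setT E.
  move=> iG iE FG.
  have iF : nu.-integrable setT (EFin \o F).
    apply: (@le_integrable _ _ _ _ _ measurableT _
      (fun x => `|(EFin \o G) x| + `|(EFin \o E) x|)%E).
    - exact/measurable_EFinP.
    - move=> x _ /=; rewrite !lee_fin (ger0_norm (addr_ge0 _ _))//.
      have := FG x; have := ler_norm (E x); have := ler_normD (F x - G x) (G x).
      by rewrite subrK; lra.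
    - apply: integrableD => //; exact: integrable_abse.
  split=> //; rewrite -RintegralB//.
  have iFG : nu.-integrable setT (EFin \o (fun x => F x - G x)).
    exact: (integrableB measurableT iF iG).
  apply: le_trans (le_normr_Rintegral _ iFG) _ => //.
  apply: le_Rintegral => //.
  exact: (integrable_norm iFG).
have [G [E [[Gn Gm _] [En Em _] FG _]]] := approx 1 ltr01.
split=> [n||]; [exact: (Fint _ _ _ (Gn n) (En n) FG).1
               |exact: (Fint _ _ _ Gm Em FG).1|].
apply/cvgrPdist_lt => e e0.
have e40 : 0 < e / 4 by lra.
have [{En Em FG Gn Gm}G' [E' [[Gn Gm Gc] [En Em Ec] FG Ee]]] := approx _ e40.
move/cvgrPdist_lt : Gc => /(_ _ e40) Gc.
move/cvgrPdist_lt : Ec => /(_ _ e40) Ec.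
near=> n.
have [_ Hm] := Fint _ _ _ Gm Em FG.
have [_ Hn] := Fint _ _ _ (Gn n) (En n) FG.
have Gcn : `|Rintegral m setT G' - Rintegral (m_ n) setT G'| < e / 4 by near: n.
have Ecn : `|Rintegral m setT E' - Rintegral (m_ n) setT E'| < e / 4 by near: n.
move: Hm Hn Gcn Ecn; rewrite !ler_norml !ltr_norml.
move=> /andP[? ?] /andP[? ?] /andP[? ?] /andP[? ?].
by apply/andP; split; lra.
Unshelve. all: by end_near. Qed.

End integral_cvg.

(** * Continuous functions on a metric space *)

Section continuous.
Context (R : realType) (S : pmetricType R).

(** The entourage of pairs at distance less than [e] separates [A] from [B], so
    that Urysohn's lemma applies. *)
Lemma separate_sets (A B : set S) (e : R) : 0 < e ->
    (forall a b, A a -> B b -> e <= mdist a b) ->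
  exists f : S -> R, [/\ continuous f, forall x, 0 <= f x <= 1,
    forall x, A x -> f x = 0 & forall x, B x -> f x = 1].
Proof.
move=> e0 AB.
have sepAB : uniform_separator A B.
  apply: uniform_separatorW.
  exists [set xy : S * S | ball xy.1 e xy.2].
    by rewrite -entourage_ballE; exists e.
  apply/seteqP; split=> // -[a b] [[/= Aa Bb]].
  by rewrite ballEmdist/= ltNge AB.
exists (Urysohn A B); split.
- exact: Urysohn_continuous.
- move=> x; have /= := @Urysohn_range _ R A B (Urysohn A B x).
  by rewrite in_itv/=; apply; exists x.
- by move=> x Ax; apply: (Urysohn_sub0 sepAB); exists x.
- by move=> x Bx; apply: (Urysohn_sub1 sepAB); exists x.
Qed.

Lemma continuous_borel (f : S -> R) : continuous f ->
  measurable_fun setT (f : borel S -> R).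
Proof.
move=> /continuousP cf; apply: (measurability _ (RGenOpens.measurableE R)).
move=> _ [_ [a [b ->] <-]]; rewrite setTI; apply: sub_sigma_algebra.
exact: cf (interval_open _ _).
Qed.

End continuous.

(** * Tonelli's theorem for finite products *)

Section prod_integral.
Context (R : realType).
Local Open Scope ereal_scope.

(** Induction on the number of factors, by Tonelli's theorem for two factors. *)
Lemma integral_prod_measure d (disp : 'I_d -> measure_display)
    (T : forall i, measurableType (disp i))
    (m : forall i, {sigma_finite_measure set (T i) -> \bar R})
    (u : forall i, T i -> R) : (forall i, measurable_fun setT (u i)) ->
    (forall i x, (0 <= u i x)%R) ->
  \int[prod_measure m]_x (\prod_(i < d) u i (x i))%:E =
  \prod_(i < d) \int[m i]_x (u i x)%:E.
Proof.
elim: d => [|d IHd] in disp T m u * => mu u0.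
  under eq_integral do rewrite big_ord0.
  by rewrite big_ord0 integral_cst//= diracT mul1e.
rewrite big_ord_recl -IHd//=.
pose F (x : prod_measurable T) : R := (\prod_(i < d.+1) u i (x i))%R.
have mprod n (disp' : 'I_n -> measure_display)
    (T' : forall i, measurableType (disp' i)) (v : forall i, T' i -> R) :
    (forall i, measurable_fun setT (v i)) ->
    measurable_fun setT
      (fun x : prod_measurable T' => \prod_(i < n) v i (x i))%R.
  move=> mv; apply: measurable_prod => i _.
  apply: (measurableT_comp (mv i)
    (_ : measurable_fun setT (fun x : prod_measurable T' => x i))).
  by move=> _ B mB; rewrite setTI; exact: (measurable_cylinder mB).
have mF : measurable_fun setT F by exact: mprod.
rewrite ge0_integral_pushforward//=; last 3 first.
- exact: measurable_prod_cons.
- exact/measurable_EFinP.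
- by move=> x _; rewrite lee_fin; exact: prodr_ge0.
rewrite preimage_setT.
have split_prod x : (\prod_(i < d.+1) u i (prod_cons x i) =
    u ord0 x.1 * \prod_(i < d) u (lift ord0 i) (x.2 i))%R.
  rewrite big_ord_recl /prod_cons dcons0; congr (_ * _)%R.
  by apply: eq_bigr => i _; rewrite dconsS.
under eq_integral do rewrite split_prod.
set V := fun y : prod_measurable (fun i => T (lift ord0 i)) =>
  (\prod_(i < d) u (lift ord0 i) (y i))%R.
have mV : measurable_fun setT V.
  exact: (mprod _ _ _ (fun i => u (lift ord0 i))).
have V0 y : (0 <= V y)%R by exact: prodr_ge0.
rewrite fubini_tonelli1; last 2 first.
- by apply/measurable_EFinP; apply: measurable_funM;
    [exact: (measurableT_comp (mu ord0) measurable_fst)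
    |exact: (measurableT_comp mV measurable_snd)].
- by move=> x; rewrite lee_fin; exact: mulr_ge0 (u0 _ _) (V0 _).
rewrite /fubini_F/=.
under eq_integral => x _.
  under eq_integral do rewrite EFinM.
  rewrite ge0_integralZl//; last 3 first.
  - exact/measurable_EFinP.
  - by move=> y _; rewrite lee_fin; exact: V0.
  - by rewrite lee_fin.
  over.
rewrite ge0_integralZr//.
- exact/measurable_EFinP.
- by move=> x _; rewrite lee_fin.
- by apply: integral_ge0 => y _; rewrite lee_fin; exact: V0.
Qed.

End prod_integral.

(** * Test functions *)

Section test_function.
Context (R : realType) (S : pmetricType R) (C : set S).
Implicit Types f v : S -> R.

(** A test function vanishes on [C], so the domain of integration may be
    enlarged to the whole space. *)
Lemma integral_test_function (mu : Mmeasure C) f : test_function C f ->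
  (\int[mu]_(x in ~` C) (f x)%:E = \int[mu]_x (f x)%:E)%E.
Proof.
move=> [_ _ _ [r r0 fr]]; rewrite integral_mkcond; apply: eq_integral => x _.
rewrite patchE; case: ifPn => //; rewrite notin_setE/= => /contrapT Cx.
by rewrite fr//; apply/enlargeP; exists x => //; rewrite mdistxx.
Qed.

(** A test function is bounded and supported in a set of finite measure. *)
Lemma integrable_test_function (mu : Mmeasure C) f : test_function C f ->
  mu.-integrable setT (EFin \o f).
Proof.
move=> [f0 [M fM] cf [r r0 fr]].
have mf := continuous_borel cf.
have mE : measurable (~` enlarge C r : set (borel S)).
  by apply: measurableC; exact: measurable_enlarge.
apply/integrableP; split; first exact/measurable_EFinP.
apply: (@le_lt_trans _ _ (\int[mu]_x (M * \1_(~` enlarge C r) x)%:E)%E).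
  apply: ge0_le_integral => //=.
  - by apply/measurable_EFinP; exact: measurableT_comp.
  - by apply/measurable_EFinP; apply: measurable_funM => //;
      exact: measurable_indic.
  - move=> x _; rewrite lee_fin ger0_norm// indicE.
    have [xE|] := boolP (x \in _).
      by rewrite mulr1.
    by rewrite notin_setE/= => /contrapT/fr ->; rewrite mulr0.
have M0 : 0 <= M by apply: le_trans (fM point).
under eq_integral do rewrite EFinM.
rewrite ge0_integralZl//; last first.
  by apply/measurable_EFinP; exact: measurable_indic.
rewrite integral_indic// setIT lte_mul_pinfty//.
exact: Mmu_fin.
Qed.

Lemma test_functionM f v : test_function C f -> continuous v ->
  (forall x, 0 <= v x <= 1) -> test_function C (fun x => v x * f x).
Proof.
move=> [f0 [M fM] cf [r r0 fr]] cv v01; split.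
- by move=> x; case/andP: (v01 x) => ? _; rewrite mulr_ge0.
- exists M => x; case/andP: (v01 x) => ? ?; apply: le_trans (fM x).
  by rewrite ler_piMl.
- by move=> x; apply: cvgM; [exact: cv|exact: cf].
- by exists r => // x /fr ->; rewrite mulr0.
Qed.

(** The test functions that localise away from [C]. *)
Lemma cutoff r : 0 < r -> exists2 f, test_function C f &
  (forall x, ~ enlarge C r x -> f x = 1).
Proof.
move=> r0; have r20 : 0 < r / 2 by lra.
have [|f [cf f01 fA fB]] := @separate_sets R S
    (enlarge C (r / 2)) (~` enlarge C r) _ r20.
  move=> a b /enlargeP[c Cc ac] nb; rewrite leNgt; apply/negP => ab; apply: nb.
  apply/enlargeP; exists c => //; apply: le_lt_trans (metric_triangle _ a _) _.
  by rewrite (metric_sym b) [ltRHS]splitr ltrD.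
exists f => //; split=> //.
- by move=> x; case/andP: (f01 x).
- by exists 1 => x; case/andP: (f01 x).
- by exists (r / 2).
Qed.

Lemma tent (p : S) (e : R) : 0 < e -> exists f : S -> R,
  [/\ continuous f, forall x, 0 <= f x <= 1,
   forall x, f x != 0 -> mdist p x < e *+ 2
   & forall x, mdist p x < e -> f x = 1].
Proof.
move=> e0.
have [|f [cf f01 fA fB]] := @separate_sets R S
    [set x | e *+ 2 <= mdist p x] [set x | mdist p x < e] _ e0.
  move=> a b /= pa pb; have := metric_triangle p b a.
  by rewrite (metric_sym b); rewrite mulr2n in pa; lra.
exists f; split => // x fx; rewrite ltNge; apply/negP => /fA fx0.
by rewrite fx0 eqxx in fx.
Qed.

Lemma dense_sequence : separable S ->
  exists s : nat -> S, forall (x : S) (e : R), 0 < e ->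
    exists n, mdist x (s n) < e.
Proof.
move=> [D /countable_injP[g ginj] dD].
exists (fun n => xget point [set y | D y /\ g y = n]) => x e e0.
have [y [xy Dy]] : ball x e `&` D !=set0.
  by apply: dD; [exists x; exact: ballxx|exact: open_metric_ball].
exists (g y); case: xgetP => [z _ [Dz gz]|/(_ y)[]//].
by rewrite (ginj z y) ?inE//; move: xy; rewrite ballEmdist.
Qed.

End test_function.

(** * Tensors *)

Section tensor.
Context (R : realType) (d : nat) (S : 'I_d -> pmetricType R).

Definition tensor (u : forall i, S i -> R) (x : prod_metric S) : R :=
  \prod_(i < d) u i (x i).

Lemma tensorM (u v : forall i, S i -> R) x :
  tensor (fun i y => v i y * u i y) x = tensor v x * tensor u x.
Proof. exact: big_split. Qed.

Lemma tensor_itv (v : forall i, S i -> R) x : (forall i y, 0 <= v i y <= 1) ->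
  0 <= tensor v x <= 1.
Proof.
move=> v01; apply/andP; split.
  by apply: prodr_ge0 => i _; case/andP: (v01 i (x i)).
by apply: prodr_ile1 => i _; exact: v01.
Qed.

(** The factors of the tensors are tents on balls of radius [2 / n.+1] around
    the points of a countable dense set; a ball on which the oscillation of [f]
    is too large is given the zero tensor.  Around each point, balls of small
    radius with center near the point qualify by continuity of [f]. *)
Lemma tensor_partition (sepS : forall i, separable (S i))
    (f : prod_metric S -> R) (e : R) : (0 < d)%N -> continuous f -> 0 < e ->
  exists (v : nat -> forall i, S i -> R) (c : nat -> R),
    [/\ forall k i, continuous (v k i), forall k i y, 0 <= v k i y <= 1,
     forall k x, tensor (v k) x != 0 -> `|f x - c k| <= e
     & forall x, exists k, tensor (v k) x = 1].
Proof.
move=> d_gt0 cf e0.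
pose s i := sval (cid (dense_sequence (sepS i))).
have sP i : forall (x : S i) (e : R), 0 < e -> exists n, mdist x (s i n) < e.
  by rewrite /s; case: cid.
have del0 n : 0 < n.+1%:R^-1 :> R by rewrite invr_gt0.
pose t i p n := sval (cid (@tent R (S i) p _ (del0 n))).
have tP i p n := svalP (cid (@tent R (S i) p _ (del0 n))).
pose pt (a : {ffun 'I_d -> nat}) : prod_metric S := fun i => s i (a i).
pose small (an : {ffun 'I_d -> nat} * nat) := `[< forall y : prod_metric S,
  (forall i, mdist (pt an.1 i) (y i) < an.2.+1%:R^-1 *+ 2) ->
  `|f y - f (pt an.1)| <= e >].
pose v k i : S i -> R := if unpickle k is Some an then
  (if small an then t i (pt an.1 i) an.2 else cst 0) else cst 0.
pose c k : R := if (unpickle k : option ({ffun 'I_d -> nat} * nat)) is Some an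
  then f (pt an.1) else 0.
(* an empty product is 1, hence the need for at least one factor *)
have tensor0 x : tensor (fun i => cst 0) x = 0 :> R.
  by rewrite /tensor (bigD1 (Ordinal d_gt0))//= mul0r.
exists v, c; split.
- move=> k i; rewrite /v; case: unpickle => [an|]; last exact: cst_continuous.
  case: ifP => _; last exact: cst_continuous.
  by have [ct _ _ _] := tP i (pt an.1 i) an.2; exact: ct.
- move=> k i y; rewrite /v.
  case: unpickle => [an|]; last by rewrite /= lexx ler01.
  case: ifP => _; last by rewrite /= lexx ler01.
  by have [_ t01 _ _] := tP i (pt an.1 i) an.2; exact: t01.
- move=> k x; rewrite /v /c.
  case: (unpickle k : option ({ffun 'I_d -> nat} * nat)) => [an|];
    last by rewrite tensor0 eqxx.
  case smallan : (small an); last by rewrite tensor0 eqxx.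
  move/asboolP : smallan => H.
  move=> /prodf_neq0 tx; apply: H => i.
  by have [_ _ H _] := tP i (pt an.1 i) an.2; exact: H (tx i isT).
- move=> x.
  have e20 : 0 < e / 2 by lra.
  have [r r0 xr] : exists2 r : R, 0 < r &
      ball x r `<=` [set y | `|f x - f y| < e / 2].
    by move/cvgrPdist_lt : (cf x) => /(_ _ e20)/nbhs_ballP[r r0 xr]; exists r.
  (* a point of the ball of radius 2 / n.+1 around a center at distance less
     than 1 / n.+1 from x is at distance less than 3 / n.+1 from x *)
  have [n nr] : exists n : nat, (n.+1%:R^-1 : R) < r / 3.
    exists (Num.truncn (r / 3)^-1).
    by rewrite invf_plt ?posrE ?divr_gt0// truncnS_gt.
  pose a := [ffun i => sval (cid (sP i (x i) _ (del0 n)))].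
  have aP i : mdist (x i) (pt a i) < n.+1%:R^-1 by rewrite /pt ffunE; case: cid.
  have near_x (y : prod_metric S) :
      (forall i, mdist (x i) (y i) < r) -> `|f x - f y| < e / 2.
    by move=> xy; apply: xr; rewrite ballEmdist/=; apply/max_dist_ltP.
  have small_an : small (a, n).
    apply/asboolP => y /= py.
    have /near_x fp : forall i, mdist (x i) (pt a i) < r.
      move=> i; apply: lt_trans (aP i) (lt_trans nr _).
      by rewrite ltr_pdivrMr// ltr_pMr// ltr1n.
    have /near_x fy : forall i, mdist (x i) (y i) < r.
      move=> i; apply: le_lt_trans (metric_triangle _ (pt a i) _) _.
      have lt3 (z : R) : z < r / 3 -> z + z *+ 2 < r by rewrite mulr2n; lra.
      exact: lt_trans (ltrD (aP i) (py i)) (lt3 _ nr).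
    rewrite distrC; have := ler_distD (f x) (f (pt a)) (f y).
    by rewrite (distrC (f (pt a)) (f x)); lra.
  exists (pickle (a, n)); rewrite /v pickleK small_an /tensor big1// => i _.
  by have [_ _ _ H] := tP i (pt a i) n; apply: H; rewrite metric_sym.
Qed.

End tensor.

(** * Convergence of the product measures *)

Section product_convergence.
Context (R : realType) (d : nat) (S : 'I_d -> pmetricType R).
Context (sepS : forall i, separable (S i)) (C : forall i, set (S i)).
Arguments C : clear implicits.
Context (clC : forall i, closed (C i)).
Arguments clC : clear implicits.

(** Moving a single coordinate is enough to reach the removed set, and the
    maximum metric charges only that coordinate. *)
Lemma enlarge_prod_removed i (r : R) (x : prod_metric S) :
  enlarge (C i) r (x i) -> 0 < r -> enlarge (prod_removed C) r x.
Proof.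
move=> /enlargeP[y Cy xy] r0; apply/enlargeP.
exists (dfwith x i y : prod_metric S).
  by exists i => //=; rewrite dfwithin.
apply/max_dist_ltP => // j; have [<-|ij] := eqVneq i j.
  by rewrite dfwithin.
by rewrite dfwithout// mdistxx.
Qed.

Lemma measurable_tensor (u : forall i, S i -> R) :
  (forall i, continuous (u i)) ->
  measurable_fun setT (tensor u : borel (prod_metric S) -> R).
Proof.
move=> cu; apply: measurable_prod => i _.
exact: measurableT_comp (continuous_borel (cu i)) (@measurable_coord R d S i).
Qed.

Lemma integral_tensor (mu : forall i, Mmeasure (C i)) (u : forall i, S i -> R) :
    (forall i, continuous (u i)) -> (forall i x, 0 <= u i x) ->
  (\int[Mproduct sepS clC mu]_x (tensor u x)%:E =
   \prod_(i < d) \int[mu i]_x (u i x)%:E)%E.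
Proof.
move=> cu u0.
rewrite (_ : integral _ _ _ = \int[pushforward
  (prod_measure (fun i => Msigma_finite (mu i) (clC i))) (@to_borel R d S)]_x
  (tensor u x)%:E)%E//.
rewrite ge0_integral_pushforward//; last 3 first.
- exact: measurable_to_borel.
- by apply/measurable_EFinP; exact: measurable_tensor.
- by move=> x _; rewrite lee_fin; exact: prodr_ge0.
rewrite preimage_setT.
exact: (integral_prod_measure (fun i => Msigma_finite (mu i) (clC i))
  (fun i => continuous_borel (cu i)) u0).
Qed.

Context (mu_ : forall i, nat -> Mmeasure (C i)) (mu : forall i, Mmeasure (C i)).
Hypothesis mu_cvg : forall i, Mcvg (mu_ i) (mu i).

Local Notation P_ := (fun n => Mproduct sepS clC (fun i => mu_ i n) :
  {measure set (borel (prod_metric S)) -> \bar R}).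
Local Notation P := (Mproduct sepS clC mu :
  {measure set (borel (prod_metric S)) -> \bar R}).

Lemma integral_tensor_test (nu : forall i, Mmeasure (C i))
    (u : forall i, S i -> R) :
    (forall i, test_function (C i) (u i)) ->
  (\int[Mproduct sepS clC nu]_x (tensor u x)%:E =
   (\prod_(i < d) Rintegral (nu i) setT (u i))%:E)%E.
Proof.
move=> tu; rewrite integral_tensor; last 2 first.
- by move=> i; have [] := tu i.
- by move=> i x; have [] := tu i.
rewrite -prodEFin; apply: eq_bigr => i _.
rewrite /Rintegral fineK//.
by apply: integrable_fin_num => //; exact: integrable_test_function.
Qed.

Lemma integrable_tensor (nu : forall i, Mmeasure (C i))
    (u : forall i, S i -> R) :
    (forall i, test_function (C i) (u i)) ->
  (Mproduct sepS clC nu).-integrable setT (EFin \o tensor u).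
Proof.
move=> tu; apply/integrableP; split.
  by apply/measurable_EFinP; apply: measurable_tensor => i; have [] := tu i.
rewrite (_ : integral _ _ _ = \int[Mproduct sepS clC nu]_x (tensor u x)%:E)%E.
  by rewrite integral_tensor_test// ltry.
apply: eq_integral => x _ /=; rewrite ger0_norm//; apply: prodr_ge0 => i _.
by have [] := tu i.
Qed.

(** Integrals of tensors are products of [d] integrals over the factors, each of
    which converges by hypothesis. *)
Lemma integral_cvg_tensor (u : forall i, S i -> R) :
  (forall i, test_function (C i) (u i)) -> integral_cvg P_ P (tensor u).
Proof.
move=> tu; split=> [n||]; try exact: integrable_tensor.
rewrite /Rintegral integral_tensor_test//=.
under eq_fun do rewrite integral_tensor_test//=.
apply: cvg_big => [|i _]; first exact: mul_continuous.
have := mu_cvg (tu i); rewrite integral_test_function//.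
under eq_fun do rewrite integral_test_function//.
rewrite -[X in _ --> X]fineK; last first.
  by apply: integrable_fin_num => //; exact: integrable_test_function.
exact: fine_cvg.
Qed.

(** Quantifying over all families of test functions, rather than over the one
    used in the end for localisation, makes this class of functions stable under
    multiplication by tensors: the new factors are absorbed into the family. *)
Definition tensor_tested (g : prod_metric S -> R) :=
  forall u : forall i, S i -> R, (forall i, test_function (C i) (u i)) ->
  integral_cvg P_ P (fun x => g x * tensor u x).

Lemma tensor_tested1 : tensor_tested (fun=> 1).
Proof.
move=> u tu; rewrite (_ : (fun x => _) = tensor u).
  exact: integral_cvg_tensor.
by apply/funext => x; rewrite mul1r.
Qed.

Lemma tensor_testedD g h : tensor_tested g -> tensor_tested h ->
  tensor_tested (fun x => g x + h x).
Proof.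
move=> tg th u tu; have := integral_cvgD (tg u tu) (th u tu).
by congr integral_cvg; apply/funext => x; rewrite mulrDl.
Qed.

Lemma tensor_testedZ c g : tensor_tested g -> tensor_tested (fun x => c * g x).
Proof.
move=> tg u tu; have := integral_cvgZ c (tg u tu).
by congr integral_cvg; apply/funext => x; rewrite mulrA.
Qed.

Lemma tensor_testedM (v : forall i, S i -> R) g :
    (forall i, continuous (v i)) -> (forall i y, 0 <= v i y <= 1) ->
  tensor_tested g ->
  tensor_tested (fun x => tensor v x * g x).
Proof.
move=> cv v01 tg u tu.
have := tg _ (fun i => test_functionM (tu i) (cv i) (v01 i)).
by congr integral_cvg; apply/funext => x; rewrite tensorM mulrCA mulrA.
Qed.

Section leftover.
Context (v : nat -> forall i, S i -> R) (c : nat -> R).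
Arguments v : clear implicits.
Hypothesis cv : forall k i, continuous (v k i).
Arguments cv : clear implicits.
Hypothesis v01 : forall k i y, 0 <= v k i y <= 1.
Arguments v01 : clear implicits.
Let h k := tensor (v k).

Lemma tensor_tested_leftover K : tensor_tested (leftover h K).
Proof.
elim: K => [|K IH].
  rewrite (_ : leftover h 0 = fun=> 1); first exact: tensor_tested1.
  by apply/funext => x; rewrite /leftover big_ord0.
rewrite (_ : leftover h K.+1 =
    fun x => leftover h K x + -1 * (h K x * leftover h K x)).
  apply: tensor_testedD => //; apply: tensor_testedZ.
  exact: (tensor_testedM (cv K) (v01 K)).
by apply/funext => x; rewrite leftoverS mulN1r.
Qed.

Lemma tensor_tested_partition_sum K : tensor_tested (partition_sum h c K).
Proof.
elim: K => [|K IH].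
  rewrite (_ : partition_sum h c 0 = fun x => 0 * 1).
    by apply: tensor_testedZ; exact: tensor_tested1.
  by apply/funext => x; rewrite /partition_sum big_ord0 mul0r.
rewrite (_ : partition_sum h c K.+1 =
    fun x => partition_sum h c K x + c K * (h K x * leftover h K x)).
  apply: tensor_testedD => //; apply: tensor_testedZ.
  exact: (tensor_testedM (cv K) (v01 K) (tensor_tested_leftover K)).
by apply/funext => x; rewrite /partition_sum big_ord_recr.
Qed.

End leftover.

Hypothesis d_gt0 : (0 < d)%N.

(** The two error terms of [partition_sum_dist] are kept below [e / 2] by the
    choice of the precision [e1] and then of the number [K] of steps. *)
Lemma Mproduct_cvg : Mcvg (fun n => Mproduct sepS clC (fun i => mu_ i n))
  (Mproduct sepS clC mu).
Proof.
move=> f tf.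
suff [_ _ fc] : integral_cvg P_ P f.
  rewrite (integral_test_function _ tf).
  under eq_fun do rewrite (integral_test_function _ tf).
  have fin (nu : Mmeasure (prod_removed C)) :
      (\int[nu]_x (f x)%:E)%E \is a fin_num.
    by apply: integrable_fin_num => //; exact: integrable_test_function.
  rewrite -(fineK (fin _)); apply/fine_cvgP; split => //.
  by apply: nearW => n; exact: fin.
have [f0 [M fM] cf [r r0 fr]] := tf.
have M0 : 0 <= M by exact: le_trans (fM point).
have phiP i := @cutoff R (S i) (C i) r r0.
pose phi i := sval (cid2 (phiP i)).
have phi_test i : test_function (C i) (phi i) by rewrite /phi; case: cid2.
have phi1 i x : ~ enlarge (C i) r x -> phi i x = 1.
  by move: x; rewrite /phi; case: cid2.
have Phi0 x : 0 <= tensor phi x.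
  by apply: prodr_ge0 => i _; have [] := phi_test i.
(* where Phi is not 1, some coordinate is near its C i, and f vanishes *)
have fPhi x : f x = f x * tensor phi x.
  have [fx0|fx0] := eqVneq (f x) 0; first by rewrite fx0 mul0r.
  rewrite /tensor big1 ?mulr1// => i _; apply: phi1 => /enlarge_prod_removed.
  by move=> /(_ r0)/fr fx; rewrite fx eqxx in fx0.
have [_ PhiP _] := integral_cvg_tensor phi_test.
set I := Rintegral P setT (tensor phi).
have I0 : 0 <= I by apply: Rintegral_ge0 => x _; exact: Phi0.
apply: integral_cvg_approx => [|e e0]; first exact: continuous_borel.
(* I and M may be 0, hence the denominators I + 1 here and M + 1 below *)
pose e1 := e / 2 / (I + 1).
have e10 : 0 < e1 by rewrite /e1 !divr_gt0// ltr_wpDl.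
have e1I : e1 * I <= e / 2.
  by rewrite /e1 -mulrA ger_pMr; [rewrite mulrC ler_pdivrMr; lra|lra].
have [v [c [cv v01 vc v1]]] := tensor_partition sepS d_gt0 cf e10.
set h := fun k => tensor (v k).
have h01 x k : 0 <= h k x <= 1 by exact: tensor_itv.
have test_leftover K := tensor_tested_leftover cv v01 K phi_test.
have leftover_cvg : Rintegral P setT
    (fun x => leftover h K x * tensor phi x) @[K --> \oo] --> (0 : R).
  apply: fine_cvg.
  rewrite (_ : 0%:E = \int[P]_x cst 0 x)%E; last by rewrite integral0.
  have [] // := @dominated_convergence _ _ _ P setT measurableT
    (fun K x => (leftover h K x * tensor phi x)%:E) (cst 0%E)
    (EFin \o tensor phi).
  - by move=> K; have [_ /measurable_int] := test_leftover K.
  - apply: aeW => x _; have [k hk1] := v1 x.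
    apply: cvg_near_cst; near=> K.
    have kK : (k < K)%N by near: K; exact: nbhs_infty_gt.
    by rewrite /leftover (bigD1 (Ordinal kK))//= /h hk1 subrr !mul0r.
  - apply: aeW => x K _; have /andP[r0' r1] := leftover_itv K (h01 x).
    by rewrite /= lee_fin ger0_norm ?mulr_ge0// ler_piMl.
have e2M : 0 < e / 2 / (M + 1) by rewrite !divr_gt0// ltr_wpDl.
move/cvgrPdist_lt : leftover_cvg => /(_ _ e2M)[K _ /(_ K (leqnn K))].
rewrite sub0r normrN => leftoverK.
exists (fun x => partition_sum h c K x * tensor phi x).
exists (fun x => e1 * tensor phi x + M * (leftover h K x * tensor phi x)).
have [_ RK _] := test_leftover K.
split.
- exact: tensor_tested_partition_sum.
- apply: integral_cvgD; apply: integral_cvgZ => //; exact: integral_cvg_tensor.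
- move=> x; rewrite {1}fPhi -mulrBl normrM (ger0_norm (Phi0 x)) mulrA -mulrDl.
  apply: ler_wpM2r => //; apply: partition_sum_dist => //.
  + by rewrite f0 fM.
  + by move=> k; exact: vc.
  + exact: ltW.
- set J := Rintegral _ _ _ in leftoverK.
  rewrite [ltLHS](_ : _ = e1 * I + M * J).
    have : M * J < e / 2.
      move: leftoverK; rewrite ltr_pdivlMr ?ltr_wpDl// => leftoverK.
      by have := ler_norm J; have := normr_ge0 J; nra.
    lra.
  rewrite -(RintegralZl e1 measurableT PhiP) -(RintegralZl M measurableT RK).
  exact: (RintegralD measurableT (integrableZl measurableT e1 PhiP)
    (integrableZl measurableT M RK)).
Unshelve. all: by end_near. Qed.

End product_convergence.

Theorem lemma2p2 (R : realType) (d : nat) (d_gt0 : (0 < d)%N)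
    (S : 'I_d -> pmetricType R) (sepS : forall i, separable (S i))
    (C : forall i, set (S i)) (clC : forall i, closed (C i))
    (mu_ : forall i, nat -> Mmeasure (C i)) (mu : forall i, Mmeasure (C i)) :
  (forall i, Mcvg (mu_ i) (mu i)) ->
  Mcvg (fun n => Mproduct sepS clC (fun i => mu_ i n)) (Mproduct sepS clC mu).
Proof. by move=> mu_cvg; exact: Mproduct_cvg. Qed.
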